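(* The following are equivalent for any ordered magma $M$. (1) $M$ is a precoherent prequantale. (2) $M$ is isomorphic (as an ordered magma) to the ideal completion $\mathrm{Idl}(N)$ under $\downarrow$-multiplication of some prequantic semilattice $N$. (3) $\mathsf{K}(M)$ is a sub prequantic semilattice of $M$ and $M$ is isomorphic to the ordered magma $\mathrm{Idl}(\mathsf{K}(M))$ under $\downarrow$-multiplication. (4) $M$ is isomorphic to $(2^N)^\star$ for some prequantic semilattice $N$ and some finitary nucleus $\star$ on $2^N$.
   Context: An ordered magma is a set with a binary operation (written multiplicatively, not assumed associative, commutative or unital) and a partial order such that $x\le x'$ and $y\le y'$ imply $xy\le x'y'$. A prequantale is an ordered magma $Q$ such that for every subset $X$ of $Q$ (including the empty set), $\bigvee X$ exists and $a(\bigvee X)=\bigvee(aX)$, $(\bigvee X)a=\bigvee(Xa)$ for all $a\in Q$. A prequantic semilattice is an ordered magma $N$ in which any two elements have a supremum, $a(x\vee y)=ax\vee ay$ and $(x\vee y)a=xa\vee ya$ for all $a,x,y\in N$, and which has a least element $0$ satisfying $0x=0=x0$ for all $x\in N$. ''$\mathsf{K}(M)$ is a sub prequantic semilattice of $M$'' means that $\mathsf{K}(M)$ is closed under multiplication, that every finite subset of $\mathsf{K}(M)$ (including $\emptyset$) has a supremum in $M$ and it lies in $\mathsf{K}(M)$, and that $\mathsf{K}(M)$ is a prequantic semilattice with the induced structure. A directed subset of a poset is a nonempty subset $\Delta$ such that every finite subset of $\Delta$ has an upper bound in $\Delta$. An element $x$ of a poset $S$ is compact if whenever $x\le\bigvee\Delta$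 for a directed $\Delta\subset S$ whose supremum exists, one has $x\le y$ for some $y\in\Delta$; $\mathsf{K}(S)$ is the set of compact elements of $S$. An ordered magma is precoherent if every element is a supremum of a set of compact elements and its set of compact elements is closed under multiplication. An ideal of a poset is a directed downward closed subset; $\mathrm{Idl}(S)$ is the set of ideals of $S$ ordered by inclusion. For a nonempty subset $X$ of a join semilattice $S$, $\downarrow\! X=\{y\in S: y\le\bigvee T\text{ for some finite nonempty }T\subset X\}$. $\downarrow$-multiplication on $\mathrm{Idl}(N)$ is $(I,J)\mapsto\,\downarrow\!(IJ)$, where $IJ=\{xy:x\in I,y\in J\}$. $2^N$ is the power set of $N$, ordered by inclusion, with multiplication $XY=\{xy:x\in X,y\in Y\}$. A closure operation is an expansive, order-preserving, idempotent self-map $\star$ ($x^\star=\star(x)$); a nucleus on an ordered magma is a closure operation with $x^\star y^\star\le(xy)^\star$ for all $x,y$; it is finitary if $(\bigvee\Delta)^\star=\bigvee\{x^\star:x\in\Delta\}$ for every directed $\Delta$ whose supremum exists. For a nucleus $\star$ on $P$, $P^\star$ is the image of $\star$ with the induced order and multiplication $(x,y)\mapsto(xy)^\star$. *)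

(* Defs.v *)
From HB Require Import structures.
From mathcomp Require Import all_boot all_order.
From mathcomp Require Import boolp classical_sets functions cardinality.

Set Implicit Arguments.
Unset Strict Implicit.
Unset Printing Implicit Defensive.

Import Order.Theory.
Local Open Scope classical_set_scope.
Local Open Scope order_scope.
Local Open Scope group_scope.

(* A [porderType] has a choice operator and a boolean-valued order; with the
   classical axioms of boolp every partially ordered type can be so equipped,
   so this loses no generality. *)
HB.mixin Record isOrderedMagma (d : Order.disp_t) T
    of Order.POrder d T & Magma T := {
  le_mulg : forall x x' y y' : T, x <= x' -> y <= y' -> x * y <= x' * y'
}.

#[short(type="orderedMagmaType")]
HB.structure Definition OrderedMagma (d : Order.disp_t) :=
  {T of isOrderedMagma d T & Order.POrder d T & Magma T}.

Definition ordered_magma_iso d d' (M : orderedMagmaType d)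
    (M' : orderedMagmaType d') (f : M -> M') : Prop :=
  [/\ bijective f, {mono f : x y / x <= y} & {morph f : x y / x * y}].

Definition isomorphic d d' (M : orderedMagmaType d) (M' : orderedMagmaType d') :
  Prop := exists f : M -> M', ordered_magma_iso f.

(* [supremums X] is the set of least upper bounds of X, so [supremums X s]
   says that the supremum of X exists and equals s. *)
Definition prequantale d (Q : orderedMagmaType d) : Prop :=
  forall X : set Q, exists2 s : Q, supremums X s &
    forall a : Q, supremums [set a * x | x in X] (a * s) /\
                  supremums [set x * a | x in X] (s * a).

Definition prequantic_semilattice d (N : orderedMagmaType d) : Prop :=
  [/\ forall x y : N, exists s, supremums [set x; y] s,
      forall a x y s : N, supremums [set x; y] s ->
        supremums [set a * x; a * y] (a * s),
      forall a x y s : N, supremums [set x; y] s ->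
        supremums [set x * a; y * a] (s * a) &
      exists2 z : N, forall x, z <= x & forall x, z * x = z /\ x * z = z].

HB.mixin Record isPrequanticSemilattice (d : Order.disp_t) T
    of OrderedMagma d T := {
  prequantic_semilatticeP : prequantic_semilattice T
}.

#[short(type="prequanticSemilatticeType")]
HB.structure Definition PrequanticSemilattice (d : Order.disp_t) :=
  {T of isPrequanticSemilattice d T & OrderedMagma d T}.

Section Posets.
Context {d : Order.disp_t} {S : porderType d}.
Implicit Types (D X I : set S) (x y : S).

Definition directed D : Prop :=
  D !=set0 /\
  forall F, finite_set F -> F `<=` D -> exists2 u, D u & ubound F u.

Definition compact_element x : Prop :=
  forall D s, directed D -> supremums D s -> x <= s -> exists2 y, D y & x <= y.

Definition downward_closed X : Prop := forall x y, X y -> x <= y -> X x.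

Definition is_ideal I : Prop := directed I /\ downward_closed I.

(* [supremums T s] also asserts that the join of T exists; in a join
   semilattice this is automatic for the finite nonempty T considered here. *)
Definition generated_ideal X : set S :=
  [set y | exists T s, [/\ finite_set T, T !=set0, T `<=` X,
                           supremums T s & y <= s]].

Definition closure_operation (star : S -> S) : Prop :=
  [/\ forall x, x <= star x,
      {homo star : x y / x <= y} &
      forall x, star (star x) = star x].

Definition finitary (star : S -> S) : Prop :=
  forall D s, directed D -> supremums D s -> supremums (star @` D) (star s).

End Posets.

Definition compact_elements d (S : porderType d) : set S :=
  [set x | compact_element x].
Arguments compact_elements {d} S.

Definition mul_closed d (M : orderedMagmaType d) (A : set M) : Prop :=
  forall x y, A x -> A y -> A (x * y).

Definition precoherent d (M : orderedMagmaType d) : Prop :=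
  (forall x : M, exists2 X, X `<=` compact_elements M & supremums X x) /\
  mul_closed (compact_elements M).

Section SubOrderedMagma.
Context {d : Order.disp_t} {M : orderedMagmaType d} {A : set M}.

Record sub_magma (mA : mul_closed A) : Type := SubMagma {
  sub_magma_val :> M;
  _ : sub_magma_val \in A
}.

Variable mA : mul_closed A.

HB.instance Definition _ := [isSub for @sub_magma_val mA].
HB.instance Definition _ := [Choice of sub_magma mA by <:].
HB.instance Definition _ := [SubChoice_isSubPOrder of sub_magma mA by <: with d].

Lemma sub_magma_subproof (x y : sub_magma mA) : val x * val y \in A.
Proof. by apply/mem_set/mA; apply/set_mem/valP. Qed.

HB.instance Definition _ := hasMul.Build (sub_magma mA)
  (fun x y => Sub (val x * val y) (sub_magma_subproof x y)).

Lemma sub_magma_le_mulg (x x' y y' : sub_magma mA) :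
  x <= x' -> y <= y' -> x * y <= x' * y'.
Proof. by rewrite -!Order.le_val; exact: le_mulg. Qed.

HB.instance Definition _ :=
  isOrderedMagma.Build d (sub_magma mA) sub_magma_le_mulg.

End SubOrderedMagma.

Record sub_prequantic_semilattice d (M : orderedMagmaType d) (A : set M) : Prop
  := SubPrequanticSemilattice {
  sub_psl_mul : mul_closed A;
  sub_psl_sup : forall F : set M, finite_set F -> F `<=` A ->
    exists2 s, supremums F s & A s;
  sub_psl_psl : prequantic_semilattice (sub_magma sub_psl_mul)
}.

Definition sub_psl d (M : orderedMagmaType d) (A : set M)
    (hA : sub_prequantic_semilattice A) : Type := sub_magma (sub_psl_mul hA).

HB.instance Definition _ d (M : orderedMagmaType d) (A : set M)
    (hA : sub_prequantic_semilattice A) := OrderedMagma.on (sub_psl hA).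
HB.instance Definition _ d (M : orderedMagmaType d) (A : set M)
    (hA : sub_prequantic_semilattice A) :=
  isPrequanticSemilattice.Build d (sub_psl hA) (sub_psl_psl hA).

(* The power set [set N] carries the library's inclusion order and the
   elementwise product. *)
HB.instance Definition _ (N : magmaType) := hasMul.Build (set N)
  (fun X Y => [set x * y | x in X & y in Y]).

Lemma set_le_mulg (N : magmaType) (X X' Y Y' : set N) :
  X <= X' -> Y <= Y' -> X * Y <= X' * Y'.
Proof.
rewrite !subsetEset => XX' YY' _ [x Xx] [y Yy] <-.
by exists x; [exact: XX'|exists y => //; exact: YY'].
Qed.

HB.instance Definition _ (N : magmaType) :=
  isOrderedMagma.Build _ (set N) (@set_le_mulg N).

Section IdealCompletion.
Context {d : Order.disp_t} (N : prequanticSemilatticeType d).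

Record Idl : Type := MkIdl {
  Idl_val :> set N;
  _ : `[< is_ideal Idl_val >]
}.

HB.instance Definition _ := [isSub for Idl_val].
HB.instance Definition _ := [Choice of Idl by <:].
HB.instance Definition _ := [SubChoice_isSubPOrder of Idl by <: with set_display].

Lemma IdlP (I : Idl) : is_ideal (val I).
Proof. by apply/asboolP; exact: valP I. Qed.

Lemma supremumsU (A B : set N) s t u :
  supremums A s -> supremums B t -> supremums [set s; t] u ->
  supremums (A `|` B) u.
Proof.
move=> [As sl] [Bt tl] [ub ul]; split=> [x [/As xs|/Bt xt]|y ABy].
- by apply: le_trans xs _; apply: ub; left.
- by apply: le_trans xt _; apply: ub; right.
- apply: ul => _ [->|->].
  + by apply: sl => x Ax; apply: ABy; left.
  + by apply: tl => x Bx; apply: ABy; right.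
Qed.

Lemma generated_ideal_ideal (X : set N) :
  X !=set0 -> is_ideal (generated_ideal X).
Proof.
move=> [x0 Xx0]; have genX0 : generated_ideal X x0.
  exists [set x0], x0; split=> //.
  - by exists x0.
  - by move=> _ ->.
  - by rewrite supremums1.
split; last first.
  by move=> x y [T [s [fT T0 TX sT ys]]] xy; exists T, s; split=> //;
     exact: le_trans ys.
split=> [|F]; first by exists x0.
case/finite_seqP=> r ->; elim: r => [_|a r IH arX].
  by exists x0 => // x; rewrite /= in_nil.
have [|v [T [s [fT T0 TX sT vs]]] ubv] := IH.
  by move=> x /= xr; apply: arX; rewrite /= inE xr orbT.
have [T' [t [fT' _ TX' tT' ta]]] : generated_ideal X a.
  by apply: arX; rewrite /= inE eqxx.
have [sup2 _ _ _] := prequantic_semilatticeP (s := N).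
have [u stu] := sup2 s t; have [ubu _] := stu.
exists u => [|x /=].
  exists (T `|` T'), u; split=> //.
  - by rewrite finite_setU.
  - by case: T0 => x Tx; exists x; left.
  - by move=> x [/TX|/TX'].
  - exact: supremumsU sT tT' stu.
rewrite inE => /predU1P[->|/ubv xv].
  by apply: le_trans ta _; apply: ubu; right.
by apply: le_trans xv _; apply: le_trans vs _; apply: ubu; left.
Qed.

Lemma mul_ideal_subproof (I J : Idl) :
  `[< is_ideal (generated_ideal (val I * val J)) >].
Proof.
apply/asboolP/generated_ideal_ideal.
have [[[x Ix] _] _] := IdlP I; have [[[y Jy] _] _] := IdlP J.
by exists (x * y), x => //; exists y.
Qed.

HB.instance Definition _ := hasMul.Build Idl
  (fun I J => Sub (generated_ideal (val I * val J)) (mul_ideal_subproof I J)).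

Lemma Idl_le_mulg (I I' J J' : Idl) : I <= I' -> J <= J' -> I * J <= I' * J'.
Proof.
rewrite -!Order.le_val => II' JJ'.
have := set_le_mulg II' JJ'; rewrite !subsetEset => sub z [T [s [fT T0 TX sT zs]]].
by exists T, s; split=> //; exact: subset_trans TX sub.
Qed.

HB.instance Definition _ := isOrderedMagma.Build _ Idl Idl_le_mulg.

End IdealCompletion.

Definition nucleus d (P : orderedMagmaType d) (star : P -> P) : Prop :=
  closure_operation star /\ forall x y, star x * star y <= star (x * y).

Section NucleusImage.
Context {d : Order.disp_t} {P : orderedMagmaType d} {star : P -> P}.

Record nucleus_image (nstar : nucleus star) : Type := NucleusImage {
  nucleus_image_val :> P;
  _ : nucleus_image_val \in range star
}.

Variable nstar : nucleus star.

HB.instance Definition _ := [isSub for @nucleus_image_val nstar].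
HB.instance Definition _ := [Choice of nucleus_image nstar by <:].
HB.instance Definition _ :=
  [SubChoice_isSubPOrder of nucleus_image nstar by <: with d].

Lemma nucleus_image_subproof (x : P) : star x \in range star.
Proof. by apply/mem_set; exists x. Qed.

HB.instance Definition _ := hasMul.Build (nucleus_image nstar)
  (fun x y => Sub (star (val x * val y)) (nucleus_image_subproof _)).

Lemma nucleus_image_le_mulg (x x' y y' : nucleus_image nstar) :
  x <= x' -> y <= y' -> x * y <= x' * y'.
Proof.
rewrite -!Order.le_val => xx' yy'; case: nstar => -[_ homo_star _] _.
by apply: homo_star; exact: le_mulg.
Qed.

HB.instance Definition _ :=
  isOrderedMagma.Build d (nucleus_image nstar) nucleus_image_le_mulg.

End NucleusImage.

(* Main.v *)
(* (1) => (3): x is recovered from the ideal of compact elements below it, and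
   a compact element below xy is, by directedness, below uv for some compact
   u <= x and v <= y.
   (2) => (4): Idl(N) is the image of the nucleus sending a subset of N to the
   smallest ideal containing it, which is finitary because a directed union of
   ideals is an ideal.
   (4) => (1): the compact elements of the image of a finitary nucleus on 2^N
   are exactly the closures of finite sets, and products of finite sets are
   finite.
   The remaining implications follow by composing these. *)
Require Import Defs.
From mathcomp Require Import all_boot all_order.
From mathcomp Require Import boolp classical_sets functions cardinality.

Set Implicit Arguments.
Unset Strict Implicit.
Unset Printing Implicit Defensive.

Import Order.Theory.
Local Open Scope classical_set_scope.
Local Open Scope order_scope.
Local Open Scope group_scope.

(** * Suprema, directed sets, compact elements and ideals in a poset *)

Section PosetSuprema.
Context {d : Order.disp_t} {S : porderType d}.
Implicit Types (X D F : set S) (x y s t : S).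

Lemma supremums_unique X s t : supremums X s -> supremums X t -> s = t.
Proof. exact: is_subset1_supremums. Qed.

Lemma supremums2P x y s : supremums [set x; y] s <->
  [/\ x <= s, y <= s & forall u, x <= u -> y <= u -> s <= u].
Proof.
split=> [[ub lub]|[xs ys lub]].
  split; [by apply: ub; left|by apply: ub; right|move=> u xu yu].
  by apply: lub => _ [->|->].
by split=> [_ [->|->]//|u ubu]; apply: lub; apply: ubu; [left|right].
Qed.

Lemma directedP D : D !=set0 ->
  (forall x y, D x -> D y -> exists u, [/\ D u, x <= u & y <= u]) -> directed D.
Proof.
move=> [x0 Dx0] D2; split=> [|F]; first by exists x0.
case/finite_seqP=> r ->; elim: r => [_|a r IH arD].
  by exists x0 => // x; rewrite /= in_nil.
have [x xr|u Du ubu] := IH; first by apply: arD; rewrite /= inE xr orbT.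
have [|v [Dv av uv]] := D2 a u _ Du; first by apply: arD; rewrite /= inE eqxx.
exists v => // x /=; rewrite inE => /predU1P[->//|/ubu xu].
exact: le_trans uv.
Qed.

Lemma directed2 D x y : directed D -> D x -> D y ->
  exists u, [/\ D u, x <= u & y <= u].
Proof.
move=> [_ dirD] Dx Dy; have [||u Du ubu] := dirD [set x; y].
- by rewrite finite_setU.
- by move=> _ [->|->].
- by exists u; split=> //; apply: ubu; [left|right].
Qed.

(** Choosing a dominating element of [D] for each member of [F] gives a finite subset of [D], which
    is bounded in [D]. *)
Lemma directed_dominates_finite D F : directed D -> finite_set F ->
  (forall x, F x -> exists2 y, D y & x <= y) -> exists2 u, D u & ubound F u.
Proof.
move=> [_ dirD] finF FD.
have /choice[g gP] : forall x, exists y, F x -> D y /\ x <= y.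
  move=> x; have [Fx|nFx] := pselect (F x); last by exists x.
  by have [y Dy xy] := FD x Fx; exists y.
have [||u Du ubu] := dirD (g @` F).
- exact: finite_image.
- by move=> _ [x Fx <-]; have [] := gP x Fx.
- exists u => // x Fx; apply: le_trans (gP x Fx).2 _.
  by apply: ubu; exists x.
Qed.

(** A directed set whose supremum dominates [s] dominates each member of [F] by compactness, hence
    all of [F] by a single element. *)
Lemma compact_finite_sup F s : finite_set F -> F `<=` compact_elements S ->
  supremums F s -> compact_element s.
Proof.
move=> finF FK [ubs lubs] D t dirD supDt st.
have [x Fx|u Du ubu] := directed_dominates_finite dirD finF.
  by apply: (FK x Fx _ t dirD supDt); exact: le_trans (ubs x Fx) st.
by exists u => //; exact: lubs.
Qed.

Lemma ideal_sup (I F : set S) s : is_ideal I -> finite_set F -> F `<=` I ->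
  supremums F s -> I s.
Proof.
move=> [[_ dirI] downI] finF FI [_ lubs].
by have [u Iu ubu] := dirI F finF FI; apply: (downI _ u) => //; exact: lubs.
Qed.

End PosetSuprema.

Lemma mono_le_inj d d' (S : porderType d) (S' : porderType d') (f : S -> S') :
  {mono f : x y / x <= y} -> injective f.
Proof.
by move=> fM x y fxy; apply: le_anti; rewrite -!fM fxy lexx.
Qed.

Lemma directed_image d d' (S : porderType d) (S' : porderType d')
    (f : S -> S') (D : set S) :
  {homo f : x y / x <= y} -> directed D -> directed (f @` D).
Proof.
move=> f_homo dirD; apply: directedP.
  by have [[x Dx] _] := dirD; exists (f x), x.
move=> _ _ [x Dx <-] [y Dy <-]; have [u [Du xu yu]] := directed2 dirD Dx Dy.
by exists (f u); split; [exists u|exact: f_homo|exact: f_homo].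
Qed.

Lemma supremums_setE (T : Type) (D : set (set T)) (s : set T) :
  supremums D s <-> s = \bigcup_(X in D) X.
Proof.
have sup_bigcup : supremums D (\bigcup_(X in D) X).
  split=> [X DX|U ubU]; first by rewrite subsetEset; exact: bigcup_sup.
  by rewrite subsetEset => x [X /ubU]; rewrite subsetEset; exact.
by split=> [/supremums_unique|->//]; exact.
Qed.

(** Order embeddings are injective by antisymmetry, so bijectivity reduces to surjectivity. *)
Lemma ordered_magma_isoP d d' (M : orderedMagmaType d) (Q : orderedMagmaType d')
    (f : M -> Q) :
  {mono f : x y / x <= y} -> {morph f : x y / x * y} ->
  (forall y, exists x, f x = y) -> ordered_magma_iso f.
Proof.
move=> f_mono f_mul /choice[g gK]; split=> //; exists g => // x.
by apply: (mono_le_inj f_mono); rewrite gK.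
Qed.

Lemma ordered_magma_iso_inv d d' (M : orderedMagmaType d)
    (Q : orderedMagmaType d') (f : M -> Q) (g : Q -> M) :
  cancel f g -> cancel g f -> ordered_magma_iso f -> ordered_magma_iso g.
Proof.
move=> fK gK [_ f_mono f_mul]; apply: ordered_magma_isoP.
- by move=> x y; rewrite -f_mono !gK.
- by move=> x y; rewrite -[LHS]fK -[RHS]fK f_mul !gK.
- by move=> x; exists (f x).
Qed.

(** * Transport along isomorphisms of ordered magmas *)

Section Transfer.
Context {d d' : Order.disp_t} {M : orderedMagmaType d}
  {Q : orderedMagmaType d'}.
Variable f : M -> Q.
Hypothesis f_iso : ordered_magma_iso f.

Lemma iso_supremums (X : set M) s :
  supremums X s <-> supremums (f @` X) (f s).
Proof.
have [[g fK gK] f_mono _] := f_iso.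
split=> -[ubs lubs]; split.
- by move=> _ [x Xx <-]; rewrite f_mono; exact: ubs.
- move=> u ubu; rewrite -[u]gK f_mono; apply: lubs => x Xx.
  by rewrite -f_mono gK; apply: ubu; exists x.
- by move=> x Xx; rewrite -f_mono; apply: ubs; exists x.
- move=> u ubu; rewrite -f_mono; apply: lubs => _ [x Xx <-].
  by rewrite f_mono; exact: ubu.
Qed.

(** Preservation of compactness follows by applying this to the inverse isomorphism. *)
Lemma iso_compact x : compact_element (f x) -> compact_element x.
Proof.
have [_ f_mono _] := f_iso; move=> fxK D s dirD supDs xs.
have [||_ [y Dy <-]] := fxK (f @` D) (f s) _ (iffLR (iso_supremums _ _) supDs).
- by apply: directed_image dirD => u v; rewrite f_mono.
- by rewrite f_mono.
- by rewrite f_mono; exists y.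
Qed.

End Transfer.

Lemma isomorphic_trans d1 d2 d3 (M1 : orderedMagmaType d1)
    (M2 : orderedMagmaType d2) (M3 : orderedMagmaType d3) :
  isomorphic M1 M2 -> isomorphic M2 M3 -> isomorphic M1 M3.
Proof.
move=> [f [f_bij f_mono f_mul]] [g [g_bij g_mono g_mul]]; exists (g \o f).
split; first exact: bij_comp.
- by move=> x y /=; rewrite g_mono f_mono.
- by move=> x y /=; rewrite f_mul g_mul.
Qed.

Section IsomorphismInvariance.
Context {d d' : Order.disp_t} (M : orderedMagmaType d)
  (Q : orderedMagmaType d').
Hypothesis MQ : isomorphic M Q.

Lemma isomorphic_prequantale : prequantale Q -> prequantale M.
Proof.
have [f f_iso] := MQ; have [[g fK gK] _ f_mul] := f_iso.
move=> Qpre X; have [s supXs mul_sup] := Qpre (f @` X).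
exists (g s) => [|a]; first by apply/(iso_supremums f_iso); rewrite gK.
have [supl supr] := mul_sup (f a).
split; apply/(iso_supremums f_iso); rewrite f_mul gK image_comp.
  move: supl; rewrite image_comp; congr (supremums _ _).
  by apply: eq_imagel => x _ /=; rewrite f_mul.
move: supr; rewrite image_comp; congr (supremums _ _).
by apply: eq_imagel => x _ /=; rewrite f_mul.
Qed.

Lemma isomorphic_precoherent : precoherent Q -> precoherent M.
Proof.
have [f f_iso] := MQ; have [[h fK hK] _ f_mul] := f_iso.
have h_iso := ordered_magma_iso_inv fK hK f_iso.
have fcompact x : compact_element x -> compact_element (f x).
  by move=> xK; apply: (iso_compact h_iso); rewrite fK.
move=> [Qalg Qmul]; split=> [x|x y xK yK].
  have [X XK supXfx] := Qalg (f x).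
  exists (h @` X).
    by move=> _ [y Xy <-]; apply: (iso_compact f_iso); rewrite hK; exact: XK.
  apply/(iso_supremums f_iso); rewrite image_comp.
  by rewrite (eq_imagel (f' := id)) ?image_id // => y _ /=; rewrite hK.
by apply: (iso_compact f_iso); rewrite f_mul; apply: Qmul; exact: fcompact.
Qed.

End IsomorphismInvariance.

Lemma generated_ideal_ge d (N : porderType d) (X : set N) :
  X `<=` generated_ideal X.
Proof.
move=> x Xx; exists [set x], x; split=> //; first by exists x.
  by move=> _ ->.
by rewrite supremums1.
Qed.

(** Ideals absorb existing finite joins of their members. In a prequantic semilattice this makes the
    ideal generated by a nonempty set the least one containing it. *)
Lemma generated_ideal_sub d (N : porderType d) (X I : set N) :
  is_ideal I -> X `<=` I -> generated_ideal X `<=` I.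
Proof.
move=> idI XI y [T [s [finT _ TX supTs ys]]]; have [_ downI] := idI.
apply: downI ys; apply: ideal_sup supTs => //; exact: subset_trans TX XI.
Qed.

(** * Compact elements of a precoherent prequantale *)

Section PrequantaleCompacts.
Context {d : Order.disp_t} (M : orderedMagmaType d).
Hypothesis M_precoherent : precoherent M.
Hypothesis M_prequantale : prequantale M.
Implicit Types (a s x y : M) (X Y : set M).

(** Uniqueness of suprema carries the distributive law from the supremum supplied by [prequantale]
    to any given [s]. *)
Lemma prequantale_sup_mull X a s :
  supremums X s -> supremums [set a * x | x in X] (a * s).
Proof.
have [t supXt /(_ a)[supl _]] := M_prequantale X.
by move=> /supremums_unique/(_ supXt) ->.
Qed.

Lemma prequantale_sup_mulr X a s :
  supremums X s -> supremums [set x * a | x in X] (s * a).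
Proof.
have [t supXt /(_ a)[_ supr]] := M_prequantale X.
by move=> /supremums_unique/(_ supXt) ->.
Qed.

(** Distributivity is applied to one factor at a time: first over [X] with [t] fixed, then over [Y]
    with [x] fixed. *)
Lemma prequantale_sup_mul X Y s t : supremums X s -> supremums Y t ->
  supremums [set x * y | x in X & y in Y] (s * t).
Proof.
move=> supX supY; split=> [_ [x Xx [y Yy <-]]|u ubu].
  by apply: le_mulg; [exact: supX.1|exact: supY.1].
apply: (prequantale_sup_mulr t supX).2 => _ [x Xx <-].
apply: (prequantale_sup_mull x supY).2 => _ [y Yy <-].
by apply: ubu; exists x => //; exists y.
Qed.

Let K := compact_elements M.
Let K_mul : mul_closed K := M_precoherent.2.

Lemma compact_finite_sup_exists (F : set M) : finite_set F -> F `<=` K ->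
  exists2 s, supremums F s & K s.
Proof.
move=> finF FK; have [s supFs _] := M_prequantale F.
by exists s => //; exact: compact_finite_sup supFs.
Qed.

Lemma compact_join x y : K x -> K y -> exists2 s, supremums [set x; y] s & K s.
Proof.
move=> Kx Ky; apply: compact_finite_sup_exists; first by rewrite finite_setU.
by move=> _ [->|->].
Qed.

(** The join in [M] of two compact elements is itself compact, so it competes among the upper bounds
    in the submagma and the two joins coincide. *)
Lemma sub_magma_supremums2 (x y s : sub_magma K_mul) :
  supremums [set x; y] s <-> supremums [set val x; val y] (val s).
Proof.
split=> [sup_xy|/supremums2P[xs ys lub]]; last first.
  by apply/supremums2P; split=> // u xu yu; exact: lub.
have [t sup_t Kt] := compact_join (set_mem (valP x)) (set_mem (valP y)).
have [xt yt lubt] := iffLR (supremums2P _ _ _) sup_t.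
have [xs ys lubs] := iffLR (supremums2P _ _ _) sup_xy.
suff -> : val s = t by [].
apply: le_anti; rewrite (lubt (val s))// andbT.
exact: (lubs (Sub t (mem_set Kt))).
Qed.

Lemma compact_prequantic_semilattice : prequantic_semilattice (sub_magma K_mul).
Proof.
split=> [x y|a x y s|a x y s|].
- have [s sup_s Ks] := compact_join (set_mem (valP x)) (set_mem (valP y)).
  by exists (Sub s (mem_set Ks)); apply/sub_magma_supremums2.
- move=> /sub_magma_supremums2/(prequantale_sup_mull (val a)).
  by rewrite image_setU !image_set1 => ?; apply/sub_magma_supremums2.
- move=> /sub_magma_supremums2/(prequantale_sup_mulr (val a)).
  by rewrite image_setU !image_set1 => ?; apply/sub_magma_supremums2.
(* The zero is the empty join; it is absorbing by distributivity over the empty set. *)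
- have [z supz Kz] := compact_finite_sup_exists (@finite_set0 M) (@sub0set _ K).
  exists (Sub z (mem_set Kz)) => x; first by apply: supz.2 => ? [].
  have := prequantale_sup_mulr (val x) supz.
  have := prequantale_sup_mull (val x) supz.
  rewrite !image_set0 => /supremums_unique/(_ supz) xz.
  by move=> /supremums_unique/(_ supz) zx; split; exact: val_inj.
Qed.

Lemma compact_sub_prequantic_semilattice : sub_prequantic_semilattice K.
Proof.
exact: SubPrequanticSemilattice compact_finite_sup_exists
  compact_prequantic_semilattice.
Qed.

Definition compacts_below x : set M := [set k | K k /\ k <= x].

Lemma compacts_below_directed x : directed (compacts_below x).
Proof.
apply: directedP => [|k l [Kk kx] [Kl lx]].
  have [z supz Kz] := compact_finite_sup_exists (@finite_set0 M) (@sub0set _ K).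
  by exists z; split=> //; apply: supz.2 => ? [].
have [s /supremums2P[ks ls lub] Ks] := compact_join Kk Kl.
by exists s; split=> //; split=> //; exact: lub.
Qed.

Lemma compacts_below_sup x : supremums (compacts_below x) x.
Proof.
have [X XK [ubx lubx]] := M_precoherent.1 x; split=> [k []//|u ubu].
by apply: lubx => k Xk; apply: ubu; split; [exact: XK|exact: ubx].
Qed.

(** Since [x] is the supremum of the compact elements below it, these determine the order;
    [below_Idl] is an order embedding for this reason. *)
Lemma compacts_below_mono x y : (forall k, K k -> k <= x -> k <= y) -> x <= y.
Proof.
by move=> xy; apply: (compacts_below_sup x).2 => k [Kk kx]; exact: xy.
Qed.

(** The products [u * v] of compact elements below [x] and [y] have supremum [x * y], and they form
    a directed set because multiplication is monotone; compactness of [k] selects one of them. *)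
Lemma compact_le_mul k x y : K k -> k <= x * y ->
  exists u v, [/\ K u, u <= x, K v, v <= y & k <= u * v].
Proof.
move=> Kk kxy.
have sup_mul :=
  prequantale_sup_mul (compacts_below_sup x) (compacts_below_sup y).
have [_ [u [Ku ux] [v [Kv vy] <-]] kuv] : exists2 w,
    [set u * v | u in compacts_below x & v in compacts_below y] w & k <= w.
  apply: (Kk _ _ _ sup_mul kxy); apply: directedP.
    have [[u ux] _] := compacts_below_directed x.
    have [[v vy] _] := compacts_below_directed y.
    by exists (u * v), u => //; exists v.
  move=> _ _ [u ux [v vy <-]] [u' u'x [v' v'y <-]].
  have [a [ax ua u'a]] := directed2 (compacts_below_directed x) ux u'x.
  have [b [bx vb v'b]] := directed2 (compacts_below_directed y) vy v'y.
  by exists (a * b); split; [exists a => //; exists b|exact: le_mulg..].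
by exists u, v.
Qed.

(** * The isomorphism with the ideal completion of the compact elements *)

Section IdealIsomorphism.
Variable hK : sub_prequantic_semilattice K.
Let S := sub_psl hK.

Lemma sub_psl_compact (k : S) : K (val k).
Proof. exact: set_mem (valP k). Qed.

Lemma compact_sub_psl k : K k -> exists k' : S, val k' = k.
Proof. by move=> Kk; exists (Sub k (mem_set Kk)). Qed.

Lemma below_ideal x : is_ideal [set k : S | val k <= x].
Proof.
split; last by move=> k l /= lx kl; exact: le_trans lx.
have dirx := compacts_below_directed x.
apply: directedP => [|k l /= kx lx].
  have [[k [/compact_sub_psl[k' <-] kx]] _] := dirx; by exists k'.
have kx' : compacts_below x (val k) by split=> //; exact: sub_psl_compact.
have lx' : compacts_below x (val l) by split=> //; exact: sub_psl_compact.
have [_ [[/compact_sub_psl[u <-] ux] ku lu]] := directed2 dirx kx' lx'.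
by exists u.
Qed.

Definition below_Idl x : Idl S := MkIdl (asboolT (below_ideal x)).

(** The inverse map sends an ideal to its supremum in [M]. *)
Lemma below_Idl_iso : ordered_magma_iso below_Idl.
Proof.
apply: ordered_magma_isoP => [x y|x y|I].
- rewrite -Order.le_val; apply/idP/idP; rewrite subsetEset => xy.
    by apply: compacts_below_mono => k /compact_sub_psl[k' <-]; exact: xy.
  by move=> k /= kx; exact: le_trans xy.
(* For products, one inclusion is [compact_le_mul]; the other holds because the ideal below [x * y]
   contains all generators [u * v]. *)
- apply: val_inj => /=; apply/seteqP; split=> [k /= kxy|].
    have [_ [_ [/compact_sub_psl[u <-] ux /compact_sub_psl[v <-] vy kuv]]] :=
      compact_le_mul (@sub_psl_compact k) kxy.
    have [_ downg] : is_ideal (generated_ideal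
        ([set k : S | val k <= x] * [set k : S | val k <= y])).
      exact: (IdlP (below_Idl x * below_Idl y)).
    apply: (downg _ (u * v)) => //.
    by apply: generated_ideal_ge; exists u => //; exists v.
  apply: generated_ideal_sub (below_ideal (x * y)) _.
  by move=> _ [u ux [v vy <-]]; exact: le_mulg.
- have [dirI downI] := IdlP I; have [s sups _] := M_prequantale (val @` val I).
  exists s; apply: val_inj; apply/seteqP; split=> k /=; last first.
    by move=> Ik; apply: sups.1; exists k.
  have dirvI : directed (val @` val I : set M) by exact: directed_image dirI.
  (* A compact element below the directed supremum [s] lies below some member of [I], hence in
     [I]. *)
  move=> /(sub_psl_compact dirvI sups)[_ [l Il <-] kl].
  exact: downI Il kl.
Qed.

End IdealIsomorphism.
End PrequantaleCompacts.

(** * The image of a nucleus on a power set *)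

Section NucleusImage.
Context (N : magmaType) (star : set N -> set N) (hstar : nucleus star).
Let Q := nucleus_image hstar.

Definition nucleus_closure (X : set N) : Q :=
  NucleusImage hstar (mem_set (imageT star X)).

Lemma nucleus_imageK (q : Q) : star (val q) = val q.
Proof.
have [[_ _ starK] _] := hstar.
by have /set_mem[X _ <-] := valP q; rewrite starK.
Qed.

Lemma nucleus_closureK (q : Q) : nucleus_closure (val q) = q.
Proof. by apply: val_inj; exact: nucleus_imageK. Qed.

Lemma nucleus_closure_image_val (D : set Q) :
  nucleus_closure @` (val @` D) = D.
Proof.
apply/seteqP; split=> [_ [_ [q Dq <-] <-]|q Dq].
  by rewrite nucleus_closureK.
by exists (val q); [exists q|exact: nucleus_closureK].
Qed.

(** This adjunction, with [nucleus_closure] left adjoint to the inclusion [val], is what makes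
    [nucleus_closure] preserve suprema. *)
Lemma nucleus_closure_le X (q : Q) :
  (nucleus_closure X <= q) = (X <= val q).
Proof.
have [[star_ge star_homo _] _] := hstar; rewrite -Order.le_val /=.
apply/idP/idP => [|Xq]; first exact: le_trans.
by rewrite -[val q]nucleus_imageK; exact: star_homo.
Qed.

Lemma nucleus_closure_homo : {homo nucleus_closure : X Y / X <= Y}.
Proof.
move=> X Y XY; rewrite nucleus_closure_le; apply: le_trans XY _.
by have [[star_ge _ _] _] := hstar; exact: star_ge.
Qed.

(** The nucleus inequality followed by idempotence gives one direction, expansiveness the other. *)
Lemma nucleus_closureM X Y :
  nucleus_closure X * nucleus_closure Y = nucleus_closure (X * Y).
Proof.
have [[star_ge star_homo starK] starM] := hstar.
apply: val_inj => /=; apply: le_anti; apply/andP; split.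
  by rewrite -[leRHS]starK; apply: star_homo; exact: starM.
by apply: star_homo; apply: le_mulg; exact: star_ge.
Qed.

Lemma nucleus_closure_sup (A : set (set N)) s :
  supremums A s -> supremums (nucleus_closure @` A) (nucleus_closure s).
Proof.
move=> [ubs lubs]; split=> [_ [X AX <-]|q ubq].
  by apply: nucleus_closure_homo; exact: ubs.
rewrite nucleus_closure_le; apply: lubs => X AX.
by rewrite -nucleus_closure_le; apply: ubq; exists X.
Qed.

(** Every family in [Q] is the image of a family of subsets of [N]. Products distribute over unions
    in the power set, and [nucleus_closure] preserves both products and suprema. *)
Lemma nucleus_image_prequantale : prequantale Q.
Proof.
move=> X; pose A := val @` X; pose s := \bigcup_(Y in A) Y.
have AX : nucleus_closure @` A = X := nucleus_closure_image_val X.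
exists (nucleus_closure s) => [|a].
  by rewrite -AX; apply: nucleus_closure_sup; apply/supremums_setE.
have supl : supremums [set val a * Y | Y in A] (val a * s).
  apply/supremums_setE/seteqP; split.
    move=> _ [x ax [y [Y AY Yy]] <-]; exists (val a * Y); first by exists Y.
    by exists x => //; exists y.
  move=> _ [_ [Y AY <-] [x ax [y Yy <-]]]; exists x => //; exists y => //.
  by exists Y.
have supr : supremums [set Y * val a | Y in A] (s * val a).
  apply/supremums_setE/seteqP; split.
    move=> _ [x [Y AY Yx] [y ay <-]]; exists (Y * val a); first by exists Y.
    by exists x => //; exists y.
  move=> _ [_ [Y AY <-] [x Yx [y ay <-]]]; exists x; first by exists Y.
  by exists y.
have mull q : a * q = nucleus_closure (val a * val q).
  by rewrite -nucleus_closureM !nucleus_closureK.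
have mulr q : q * a = nucleus_closure (val q * val a).
  by rewrite -nucleus_closureM !nucleus_closureK.
split.
- have -> : a * nucleus_closure s = nucleus_closure (val a * s).
    by rewrite -nucleus_closureM nucleus_closureK.
  have -> : [set a * q | q in X] =
      nucleus_closure @` [set val a * Y | Y in A].
    by rewrite !image_comp; apply: eq_imagel => q _; exact: mull.
  exact: nucleus_closure_sup.
- have -> : nucleus_closure s * a = nucleus_closure (s * val a).
    by rewrite -nucleus_closureM nucleus_closureK.
  have -> : [set q * a | q in X] =
      nucleus_closure @` [set Y * val a | Y in A].
    by rewrite !image_comp; apply: eq_imagel => q _; exact: mulr.
  exact: nucleus_closure_sup.
Qed.

Let finite_closures (q : Q) : set Q :=
  nucleus_closure @` [set F | finite_set F /\ F `<=` val q].

Lemma finite_closures_directed q : directed (finite_closures q).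
Proof.
apply: directed_image; first exact: nucleus_closure_homo.
apply: directedP; first by exists set0; split; [exact: finite_set0|].
move=> F G [finF Fq] [finG Gq]; exists (F `|` G); split.
- by split; [rewrite finite_setU|rewrite subUset].
- by rewrite subsetEset; exact: subsetUl.
- by rewrite subsetEset; exact: subsetUr.
Qed.

(** A set is the union of its finite subsets, and [nucleus_closure] preserves this supremum. *)
Lemma finite_closures_sup q : supremums (finite_closures q) q.
Proof.
rewrite -[X in supremums _ X]nucleus_closureK; apply: nucleus_closure_sup.
apply/supremums_setE/seteqP; split=> [x qx|x [F [_ Fq] /Fq//]].
by exists [set x] => //; split; [exact: finite_set1|move=> _ ->].
Qed.

(** Compactness is tested on the directed family of closures of finite subsets of [q], whose
    supremum is [q]. *)
Lemma compact_nucleus_closure (q : Q) : compact_element q ->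
  exists2 F, finite_set F & q = nucleus_closure F.
Proof.
move=> qK; have [_ [F [finF Fq] <-] qF] :=
  qK _ _ (finite_closures_directed q) (finite_closures_sup q) (lexx q).
exists F => //; apply: le_anti; rewrite qF nucleus_closure_le /=.
by rewrite subsetEset.
Qed.

Hypothesis fstar : finitary star.

(** Directed suprema in [Q] are plain unions when [star] is finitary, and a finite set inside a
    directed union lies inside one member. *)
Lemma finite_nucleus_closure_compact F :
  finite_set F -> compact_element (nucleus_closure F).
Proof.
move=> finF D s dirD supDs; rewrite nucleus_closure_le subsetEset => Fs.
have dirV : directed (val @` D) by apply: directed_image dirD.
pose U := \bigcup_(Y in val @` D) Y.
have supU : supremums (val @` D) U by apply/supremums_setE.
(* By finitarity [star U] is the supremum of the closures of the members, which are already
   closed. *)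
have starU : star U = U.
  apply: supremums_unique (supU); have := fstar dirV supU.
  rewrite image_comp; congr (supremums _ _); apply: eq_imagel => q _ /=.
  exact: nucleus_imageK.
have sU : val s = U.
  rewrite -starU; have := nucleus_closure_sup supU.
  by rewrite nucleus_closure_image_val => /(supremums_unique supDs) ->.
(* Points of [F] become singletons so that domination can be expressed by inclusion. *)
have finF1 : finite_set [set [set x] | x in F] by exact: finite_image.
have [|_ [q Dq <-] Fq] := directed_dominates_finite dirV finF1.
  move=> _ [x Fx <-]; have := Fs x Fx; rewrite sU => -[Y DY Yx].
  by exists Y => //; rewrite subsetEset => _ ->.
exists q => //; rewrite nucleus_closure_le subsetEset => x Fx.
have /Fq : [set [set y] | y in F] [set x] by exists x.
by rewrite subsetEset; exact.
Qed.

Lemma nucleus_image_precoherent : precoherent Q.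
Proof.
split=> [q|x y].
  exists (finite_closures q); last exact: finite_closures_sup.
  by move=> _ [F [finF _] <-]; exact: finite_nucleus_closure_compact.
move=> /compact_nucleus_closure[F finF ->] /compact_nucleus_closure[G finG ->].
rewrite nucleus_closureM; apply: finite_nucleus_closure_compact.
exact: finite_image2.
Qed.

End NucleusImage.

(** * The ideal closure as a finitary nucleus on the power set *)

Section IdealClosure.
Context {d : Order.disp_t} (N : prequanticSemilatticeType d).
Implicit Types (X Y I J : set N) (x y : N).

Lemma ideal_join I x y s :
  is_ideal I -> supremums [set x; y] s -> I x -> I y -> I s.
Proof.
by move=> idI sup_s Ix Iy; apply: ideal_sup sup_s => // _ [->|->].
Qed.

Lemma join_closed_ideal I : I !=set0 -> downward_closed I ->
  (forall x y s, supremums [set x; y] s -> I x -> I y -> I s) -> is_ideal I.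
Proof.
move=> I0 downI joinI; split=> //; apply: directedP => // x y Ix Iy.
have [join_ex _ _ _] := prequantic_semilatticeP (s := N).
have [s sup_s] := join_ex x y; exists s.
have [xs ys _] := iffLR (supremums2P _ _ _) sup_s.
by split=> //; exact: joinI sup_s _ _.
Qed.

Lemma ideal_zero I z : (forall x, z <= x) -> is_ideal I -> I z.
Proof. by move=> z_le [[[x Ix] _] downI]; exact: downI Ix _. Qed.

(** An intersection of ideals, unlike [generated_ideal], also treats the empty set correctly: its
    closure is the zero ideal, whereas [generated_ideal set0] is empty. *)
Definition ideal_closure X : set N :=
  [set x | forall I, is_ideal I -> X `<=` I -> I x].

(** The least element lies in every ideal, so the intersection is nonempty. *)
Lemma ideal_closure_ideal X : is_ideal (ideal_closure X).
Proof.
have [_ _ _ [z z_le _]] := prequantic_semilatticeP (s := N).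
apply: join_closed_ideal => [|x y cy xy I idI XI|x y s sup_s cx cy I idI XI].
- by exists z => I idI _; exact: ideal_zero.
- exact: idI.2 (cy I idI XI) xy.
- by apply: ideal_join sup_s _ _ => //; [exact: cx|exact: cy].
Qed.

Lemma ideal_closure_ge X : X `<=` ideal_closure X.
Proof. by move=> x Xx I _; exact. Qed.

Lemma ideal_closure_id I : is_ideal I -> ideal_closure I = I.
Proof.
move=> idI; apply/seteqP; split; last exact: ideal_closure_ge.
by move=> x; exact.
Qed.

(* For an ideal [J] containing [XY], the residuals [{y | xy \in J}] and
   [{x | xy \in J}] are again ideals. *)
Lemma ideal_closureM X Y :
  ideal_closure X * ideal_closure Y `<=` ideal_closure (X * Y).
Proof.
have [_ mul_supl mul_supr [z z_le z_mul]] := prequantic_semilatticeP (s := N).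
move=> _ [x cx [y cy <-]] J idJ XYJ.
have J0 : J z := ideal_zero z_le idJ.
(* Absorption by zero gives nonemptiness, monotonicity downward closure, and distributivity closure
   under joins. *)
have residl a : is_ideal [set b | J (a * b)].
  apply: join_closed_ideal => [|b c /= Jc bc|b c s sup_s /= Jb Jc].
  - by exists z; rewrite /= (z_mul a).2.
  - by apply: idJ.2 Jc _; exact: le_mulg.
  - exact: ideal_join (mul_supl _ _ _ _ sup_s) _ _.
have residr b : is_ideal [set a | J (a * b)].
  apply: join_closed_ideal => [|a c /= Jc ac|a c s sup_s /= Ja Jc].
  - by exists z; rewrite /= (z_mul b).1.
  - by apply: idJ.2 Jc _; exact: le_mulg.
  - exact: ideal_join (mul_supr _ _ _ _ sup_s) _ _.
(* The residual at [y] reduces [x] to a member of [X]; the residual at that member then reduces [y]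
   to a member of [Y]. *)
apply: (cx _ (residr y)) => a Xa; apply: (cy _ (residl a)) => b Yb.
by apply: XYJ; exists a => //; exists b.
Qed.

Lemma ideal_closure_nucleus : nucleus ideal_closure.
Proof.
split=> [|X Y]; last by rewrite subsetEset; exact: ideal_closureM.
split=> [X|X Y|X]; first by rewrite subsetEset; exact: ideal_closure_ge.
  rewrite !subsetEset => XY x cx I idI YI; apply: cx => //.
  exact: subset_trans XY YI.
exact/ideal_closure_id/ideal_closure_ideal.
Qed.

Lemma ideal_closure_finitary : finitary ideal_closure.
Proof.
have [[c_ge c_homo _] _] := ideal_closure_nucleus.
move=> D s dirD /supremums_setE ->; apply/supremums_setE/seteqP; split.
  (* The union of the closures contains the union of [D], so it suffices that it is an ideal. *)
  move=> x; apply; last first.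
    move=> y [X DX Xy]; exists (ideal_closure X); first by exists X.
    exact: ideal_closure_ge.
  apply: join_closed_ideal => [|y u [_ [X DX <-] cu] yu|y u t sup_t].
  - have [[X DX] _] := dirD.
    have [[[y cy] _] _] := ideal_closure_ideal X.
    by exists y, (ideal_closure X) => //; exists X.
  - exists (ideal_closure X); first by exists X.
    exact: (ideal_closure_ideal X).2 cu yu.
  - move=> [_ [X DX <-] cy] [_ [Y DY <-] cu].
    (* Directedness puts both elements in the closure of one [Z], where their join can be taken. *)
    have [Z [DZ /c_homo XZ /c_homo YZ]] := directed2 dirD DX DY.
    exists (ideal_closure Z); first by exists Z.
    apply: ideal_join sup_t _ _; first exact: ideal_closure_ideal.
      by move: XZ; rewrite subsetEset; exact.
    by move: YZ; rewrite subsetEset; exact.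
move=> x [_ [X DX <-] cx]; have : X <= \bigcup_(Y in D) Y.
  by rewrite subsetEset; exact: bigcup_sup.
by move=> /c_homo; rewrite subsetEset; exact.
Qed.

(** Both sides are the least ideal containing [X]. *)
Lemma generated_ideal_closure X :
  X !=set0 -> generated_ideal X = ideal_closure X.
Proof.
move=> X0; apply/seteqP; split.
  exact: generated_ideal_sub (ideal_closure_ideal X) (@ideal_closure_ge X).
move=> x; apply; last exact: generated_ideal_ge.
exact: generated_ideal_ideal.
Qed.

(** The closed sets are exactly the ideals, ordered by inclusion on both sides; the products agree
    because a product of two ideals is nonempty. *)
Lemma Idl_isomorphic_nucleus_image :
  isomorphic (Idl N) (nucleus_image ideal_closure_nucleus).
Proof.
have I_closed (I : Idl N) : val I \in range ideal_closure.
  by apply/mem_set; exists (val I) => //; exact/ideal_closure_id/IdlP.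
exists (fun I : Idl N => NucleusImage ideal_closure_nucleus (I_closed I)).
apply: ordered_magma_isoP => [//|I J|q].
- apply: val_inj => /=; apply: generated_ideal_closure.
  have [[[x Ix] _] _] := IdlP I; have [[[y Jy] _] _] := IdlP J.
  by exists (x * y), x => //; exists y.
- have id_q : is_ideal (val q).
    by rewrite -nucleus_imageK; exact: ideal_closure_ideal.
  by exists (MkIdl (asboolT id_q)); exact: val_inj.
Qed.

End IdealClosure.

(** * The cycle of implications *)

Theorem corollary7p8 (d : Order.disp_t) (M : orderedMagmaType d) :
  [<-> precoherent M /\ prequantale M;
       exists (d' : Order.disp_t) (N : prequanticSemilatticeType d'),
         isomorphic M (Idl N);
       exists hK : sub_prequantic_semilattice (compact_elements M),
         isomorphic M (Idl (sub_psl hK));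
       exists (d' : Order.disp_t) (N : prequanticSemilatticeType d')
              (star : set N -> set N) (hstar : nucleus star),
         finitary star /\ isomorphic M (nucleus_image hstar)].
Proof.
have iso_Idl_compacts : precoherent M /\ prequantale M ->
    exists hK : sub_prequantic_semilattice (compact_elements M),
      isomorphic M (Idl (sub_psl hK)).
  move=> [Mcoh Mpre]; exists (compact_sub_prequantic_semilattice Mcoh Mpre).
  by eexists; exact: below_Idl_iso.
have nucleus_of_Idl d' (N : prequanticSemilatticeType d') :
    isomorphic M (Idl N) ->
    isomorphic M (nucleus_image (ideal_closure_nucleus N)).
  by move=> /isomorphic_trans; apply; exact: Idl_isomorphic_nucleus_image.
have coherent_of_nucleus d' (N : prequanticSemilatticeType d')
    (star : set N -> set N) (hstar : nucleus star) :
    finitary star -> isomorphic M (nucleus_image hstar) ->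
    precoherent M /\ prequantale M.
  move=> fstar MQ; split.
    exact: isomorphic_precoherent MQ (nucleus_image_precoherent hstar fstar).
  exact: isomorphic_prequantale MQ (@nucleus_image_prequantale _ _ hstar).
tfae.
(* (1) gives (2) with the compact elements of [M] as [N]. *)
- by move=> /iso_Idl_compacts[hK MK]; exists d, (sub_psl hK).
(* An arbitrary [N] is exchanged for the compact elements of [M] by passing through (4) and (1). *)
- move=> [d' [N /nucleus_of_Idl MN]]; apply: iso_Idl_compacts.
  exact: coherent_of_nucleus (@ideal_closure_finitary _ N) MN.
- move=> [hK MK]; exists d, (sub_psl hK), (@ideal_closure _ (sub_psl hK)).
  exists (ideal_closure_nucleus _).
  by split; [exact: ideal_closure_finitary|exact: nucleus_of_Idl].
- by move=> [d' [N [star [hstar [fstar MQ]]]]]; exact: coherent_of_nucleus MQ.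
Qed.
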